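(* Let $\mathsf{K}$ be a universal class of $\mathcal{L}$-algebras. The first-order theory $\mathrm{Th}(\mathsf{K})$ has a model completion if, and only if, $\mathsf{K}$ has the amalgamation property, the variable projection property, and the conservative model extension property.
   Context: Fix an algebraic first-order language $\mathcal{L}$ (no relation symbols) containing at least one constant symbol $c$; algebras are $\mathcal{L}$-structures. Equations are atomic formulas $s\approx t$; literals are equations and negated equations; $\top$ is $c\approx c$ and $\bot$ is $\neg\top$. For a class $\mathsf{K}$ of algebras and a quantifier-free formula $\alpha$, $\mathsf{K}\models\alpha$ means every member of $\mathsf{K}$ satisfies $\alpha$ under every assignment. For a conjunction of literals $\psi$, $\psi^+$ denotes the conjunction of the equations occurring positively in $\psi$ and $\psi^-$ the conjunction of the equations occurring negated in $\psi$. Writing $\alpha(\overline{x})$ means the free variables of $\alpha$ lie in the set $\overline{x}$; $\overline{x},y$ denotes a finite set of variables $\overline{x}$ together with a variable $y\notin\overline{x}$. A universal class is a class of algebras closed under isomorphic images, subalgebras and ultraproducts (equivalently, axiomatized by universal sentences). $\mathrm{Th}(\mathsf{K})$ is the set of sentences true in all members of $\mathsf{K}$. A model completion of a theory $T$ is a model complete theory $T^*$ (every embedding between models of $T^*$ is elementary) that entails the same universal sentences as $T$ and such that for every model $M$ of $T$, $T^*$ together with the diagram of $M$ is complete. $\mathsf{K}$ has the amalgamation property if for all $\mathbf{A},\mathbf{B},\mathbf{C}\in\mathsf{K}$ and embeddings $f\colon\mathbf{A}\to\mathbf{B}$, $g\colon\mathbf{A}\to\mathbf{C}$ there are $\mathbf{D}\in\mathsf{K}$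 and embeddings $h\colon\mathbf{B}\to\mathbf{D}$, $k\colon\mathbf{C}\to\mathbf{D}$ with $hf=kg$. $\mathsf{K}$ has the variable projection property if for any finite set $\overline{x},y$ and conjunction of equations $\varphi(\overline{x},y)$ there is a quantifier-free formula $\xi(\overline{x})$ such that $\mathsf{K}\models\varphi\to\xi$ and for every equation $\varepsilon(\overline{x})$, $\mathsf{K}\models\varphi\to\varepsilon$ implies $\mathsf{K}\models\xi\to\varepsilon$. $\mathsf{K}$ has the conservative model extension property if for any finite set $\overline{x},y$ and conjunction of literals $\psi(\overline{x},y)$ there is a quantifier-free formula $\chi(\overline{x})$ such that (i) $\mathsf{K}\models\psi\to\chi$, and (ii) for every $\mathbf{A}\in\mathsf{K}$ generated by a tuple $\overline{a}\in A^{\overline{x}}$ with $\mathbf{A}\models\chi(\overline{a})$ and such that $\mathbf{A}\models\varepsilon(\overline{a})$ for every equation $\varepsilon(\overline{x})$ with $\mathsf{K}\models\psi^+\to\varepsilon$, there exist $\mathbf{B}\in\mathsf{K}$ extending $\mathbf{A}$ and $b\in B$ with $\mathbf{B}\models\psi(\overline{a},b)$. *)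

(* Defs.v *)
From mathcomp Require Import all_boot.
Set Implicit Arguments. Unset Strict Implicit. Unset Printing Implicit Defensive.

Record lang := Lang {
  fsym : Type;
  arity : fsym -> nat;
  csym : fsym;
  csym_const : arity csym = 0 }.

Section Syntax.
Variable L : lang.

Inductive term : Type :=
| Var : nat -> term
| App : forall f : fsym L, ('I_(arity f) -> term) -> term.
Arguments App f ts.

Inductive formula : Type :=
| Feq : term -> term -> formula
| Fnot : formula -> formula
| Fand : formula -> formula -> formula
| For : formula -> formula -> formula
| Fimp : formula -> formula -> formula
| Fall : nat -> formula -> formula
| Fex : nat -> formula -> formula.

Fixpoint fv_term (t : term) : seq nat :=
  match t with
  | Var n => [:: n]
  | App f ts => flatten (map (fun i => fv_term (ts i)) (enum 'I_(arity f)))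
  end.

Fixpoint fv (phi : formula) : seq nat :=
  match phi with
  | Feq s t => fv_term s ++ fv_term t
  | Fnot p => fv p
  | Fand p q | For p q | Fimp p q => fv p ++ fv q
  | Fall x p | Fex x p => filter (predC1 x) (fv p)
  end.

Definition sentence (phi : formula) : Prop := fv phi = [::].

Fixpoint qf (phi : formula) : Prop :=
  match phi with
  | Feq _ _ => True
  | Fnot p => qf p
  | Fand p q | For p q | Fimp p q => qf p /\ qf q
  | Fall _ _ | Fex _ _ => False
  end.

Fixpoint universal (phi : formula) : Prop :=
  match phi with
  | Fall _ p => universal p
  | _ => qf phi
  end.

Definition cterm : term := @App (csym L) (fun _ => Var 0).
Definition Ftop : formula := Feq cterm cterm.

Definition eqn := (term * term)%type.
Definition lit := (bool * eqn)%type.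

Definition conj_eqs (es : seq eqn) : formula :=
  foldr (fun e acc => Fand (Feq e.1 e.2) acc) Ftop es.

Definition lit_form (l : lit) : formula :=
  if l.1 then Feq l.2.1 l.2.2 else Fnot (Feq l.2.1 l.2.2).

Definition conj_lits (ls : seq lit) : formula :=
  foldr (fun l acc => Fand (lit_form l) acc) Ftop ls.

Definition lits_pos (ls : seq lit) : formula :=
  conj_eqs [seq l.2 | l <- ls & l.1].

End Syntax.

Arguments Var {L}.
Arguments App {L} f ts.

Section Semantics.
Variable L : lang.

Record algebra := Algebra {
  carrier :> Type;
  op : forall f : fsym L, (arity f).-tuple carrier -> carrier }.

Definition upd (A : Type) (env : nat -> A) (x : nat) (a : A) : nat -> A :=
  fun v => if v == x then a else env v.

Fixpoint eval (A : algebra) (env : nat -> A) (t : term L) : A :=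
  match t with
  | Var n => env n
  | App f ts => op (mktuple (fun i => eval env (ts i)))
  end.

Fixpoint sat (A : algebra) (env : nat -> A) (phi : formula L) : Prop :=
  match phi with
  | Feq s t => eval env s = eval env t
  | Fnot p => ~ sat env p
  | Fand p q => sat env p /\ sat env q
  | For p q => sat env p \/ sat env q
  | Fimp p q => sat env p -> sat env q
  | Fall x p => forall a : A, sat (upd env x a) p
  | Fex x p => exists a : A, sat (upd env x a) p
  end.

Definition holds (A : algebra) (phi : formula L) : Prop :=
  forall env : nat -> A, sat env phi.

Definition Kmodels (K : algebra -> Prop) (phi : formula L) : Prop :=
  forall A, K A -> holds A phi.

Definition theory := formula L -> Prop.

Definition is_model (T : theory) (A : algebra) : Prop :=
  forall phi, T phi -> holds A phi.

Definition entails (T : theory) (phi : formula L) : Prop :=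
  forall A, is_model T A -> holds A phi.

Definition Th (K : algebra -> Prop) : theory :=
  fun phi => sentence phi /\ Kmodels K phi.

Definition universal_class (K : algebra -> Prop) : Prop :=
  exists Sigma : theory,
    (forall phi, Sigma phi -> sentence phi /\ universal phi) /\
    (forall A, K A <-> is_model Sigma A).

Definition embedding (A B : algebra) (h : A -> B) : Prop :=
  injective h /\
  forall (f : fsym L) (args : (arity f).-tuple A),
    h (op args) = op (map_tuple h args).

Definition elementary (A B : algebra) (h : A -> B) : Prop :=
  forall (phi : formula L) (env : nat -> A), sat env phi <-> sat (h \o env) phi.

Definition model_complete (T : theory) : Prop :=
  forall (A B : algebra) (h : A -> B),
    is_model T A -> is_model T B -> embedding h -> elementary h.

(* T together with the diagram of M is complete: it has a model, and for every
   sentence with parameters from M (a formula phi with assignment env into M),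
   either all models (N, h : M -> N embedding, N |= T) satisfy it, or all
   satisfy its negation. *)
Definition diagram_complete (T : theory) (M : algebra) : Prop :=
  (exists (N : algebra) (h : M -> N), is_model T N /\ embedding h) /\
  forall (phi : formula L) (env : nat -> M),
    (forall (N : algebra) (h : M -> N), is_model T N -> embedding h ->
        sat (h \o env) phi) \/
    (forall (N : algebra) (h : M -> N), is_model T N -> embedding h ->
        ~ sat (h \o env) phi).

Definition model_completion (T Tstar : theory) : Prop :=
  (forall phi, Tstar phi -> sentence phi) /\
  model_complete Tstar /\
  (forall phi, sentence phi -> universal phi ->
     (entails T phi <-> entails Tstar phi)) /\
  (forall M, is_model T M -> diagram_complete Tstar M).

Definition has_model_completion (T : theory) : Prop :=
  exists Tstar : theory, model_completion T Tstar.

Definition amalgamation (K : algebra -> Prop) : Prop :=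
  forall (A B C : algebra) (f : A -> B) (g : A -> C),
    K A -> K B -> K C -> embedding f -> embedding g ->
    exists (D : algebra) (h : B -> D) (k : C -> D),
      K D /\ embedding h /\ embedding k /\ forall a, h (f a) = k (g a).

Definition variable_projection (K : algebra -> Prop) : Prop :=
  forall (xs : seq nat) (y : nat) (es : seq (eqn L)),
    y \notin xs ->
    {subset fv (conj_eqs es) <= y :: xs} ->
    exists xi : formula L,
      qf xi /\ {subset fv xi <= xs} /\
      Kmodels K (Fimp (conj_eqs es) xi) /\
      forall s t : term L, {subset fv (Feq s t) <= xs} ->
        Kmodels K (Fimp (conj_eqs es) (Feq s t)) ->
        Kmodels K (Fimp xi (Feq s t)).

Definition generated (A : algebra) (S0 : A -> Prop) : Prop :=
  forall S : A -> Prop,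
    (forall a, S0 a -> S a) ->
    (forall (f : fsym L) (args : (arity f).-tuple A),
        (forall i, S (tnth args i)) -> S (op args)) ->
    forall a, S a.

Definition conservative_model_extension (K : algebra -> Prop) : Prop :=
  forall (xs : seq nat) (y : nat) (ls : seq (lit L)),
    y \notin xs ->
    {subset fv (conj_lits ls) <= y :: xs} ->
    exists chi : formula L,
      qf chi /\ {subset fv chi <= xs} /\
      Kmodels K (Fimp (conj_lits ls) chi) /\
      forall (A : algebra) (env : nat -> A),
        K A ->
        generated (fun a => exists2 x, x \in xs & a = env x) ->
        sat env chi ->
        (forall s t : term L, {subset fv (Feq s t) <= xs} ->
           Kmodels K (Fimp (lits_pos ls) (Feq s t)) -> sat env (Feq s t)) ->
        exists (B : algebra) (h : A -> B) (b : B),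
          K B /\ embedding h /\ sat (upd (h \o env) y b) (conj_lits ls).

End Semantics.

(* Main.v *)
(** The model completion is the theory of the existentially closed members of
[K].  Amalgamation lets one solve all solvable systems of literals over a given
member at once (in an ultraproduct), so that every member embeds in the limit of
an omega-chain which is existentially closed.  The conjunction of the two
formulas given by variable projection and conservative extension expresses that
a system of literals is solvable in some extension; this axiomatises existential
closedness.

Quantifier elimination is obtained in both directions from one compactness
argument: a formula whose truth in models of [T] depends only on the equations
satisfied by its parameters is [T]-equivalent to a quantifier-free one.  The
dependence itself holds because two tuples satisfying the same equations
generate isomorphic subalgebras, over which one can amalgamate (or invoke the
completeness of the diagram).  Conversely, eliminating the quantifier in
[exists y, psi] yields both formulas at once, and two models of the completion
over a common subalgebra are elementarily equivalent over it, so that one embeds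
in an ultrapower of the other. *)

Require Import Defs.
From mathcomp Require Import all_boot.
From mathcomp Require Import boolp classical_sets filter.
Set Implicit Arguments. Unset Strict Implicit. Unset Printing Implicit Defensive.

(** * Satisfaction, free variables and embeddings *)

Section Satisfaction.
Variable L : lang.

Lemma eval_ext (A : algebra L) (e e' : nat -> A) (t : term L) :
  {in fv_term t, e =1 e'} -> eval e t = eval e' t.
Proof.
elim: t => [n|f ts IH] /= ee'; first by apply: ee'; rewrite inE.
congr op; apply: eq_mktuple => i; apply: IH => x xi.
by apply: ee'; apply/flatten_mapP; exists i; rewrite ?mem_enum.
Qed.

Lemma upd_other (A : Type) (e : nat -> A) x a v : v != x -> upd e x a v = e v.
Proof. by rewrite /upd => /negPf->. Qed.

Lemma upd_id (A : Type) (e : nat -> A) x : upd e x (e x) = e.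
Proof. by apply/funext => v; rewrite /upd; case: eqP => [->|]. Qed.

Lemma upd_comp (A B : Type) (h : A -> B) (e : nat -> A) x a :
  h \o upd e x a = upd (h \o e) x (h a).
Proof. by apply/funext => v; rewrite /= /upd; case: eqP. Qed.

Lemma upd_agree (A : Type) (e e' : nat -> A) x a (s : seq nat) :
  {in [seq v <- s | predC1 x v], e =1 e'} -> {in s, upd e x a =1 upd e' x a}.
Proof.
move=> ee' v vs; rewrite /upd; case: eqP => // /eqP vx.
by apply: ee'; rewrite mem_filter /= vx.
Qed.

Lemma sat_ext (A : algebra L) (phi : formula L) (e e' : nat -> A) :
  {in fv phi, e =1 e'} -> sat e phi <-> sat e' phi.
Proof.
have cat_in (f g : nat -> A) s1 s2 : {in s1 ++ s2, f =1 g} ->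
    {in s1, f =1 g} /\ {in s2, f =1 g}.
  by move=> h; split=> x xs; apply: h; rewrite mem_cat xs ?orbT.
elim: phi e e' => [s t|p IH|p IHp q IHq|p IHp q IHq|p IHp q IHq|x p IH|x p IH]
  /= e e'.
- by move=> /cat_in[hs ht]; rewrite (eval_ext hs) (eval_ext ht).
- by move=> /IH; tauto.
- by move=> /cat_in[/IHp hp /IHq hq]; tauto.
- by move=> /cat_in[/IHp hp /IHq hq]; tauto.
- by move=> /cat_in[/IHp hp /IHq hq]; tauto.
- move=> h; split=> H a; have := H a.
    by move/(IH _ _ (upd_agree a h)).
  by move/(IH _ _ (upd_agree a h)).
- move=> h; split=> -[a H]; exists a; move: H.
    by move/(IH _ _ (upd_agree a h)).
  by move/(IH _ _ (upd_agree a h)).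
Qed.

Lemma embedding_comp (A B C : algebra L) (f : A -> B) (g : B -> C) :
  embedding f -> embedding g -> embedding (g \o f).
Proof.
move=> [fi fo] [gi go]; split; first exact: inj_comp.
move=> s args /=; rewrite fo go; congr op; apply: eq_from_tnth => i.
by rewrite !tnth_map.
Qed.

Lemma embedding_id (A : algebra L) : embedding (@id A).
Proof.
split=> // s args; congr op; apply: eq_from_tnth => i; by rewrite !tnth_map.
Qed.

Lemma eval_embedding (A B : algebra L) (h : A -> B) (e : nat -> A) (t : term L) :
  embedding h -> eval (h \o e) t = h (eval e t).
Proof.
move=> [_ ho]; elim: t => [n|f ts IH] //=; rewrite ho; congr op.
by apply: eq_from_tnth => i; rewrite tnth_mktuple tnth_map tnth_mktuple.
Qed.

Lemma sat_embedding (A B : algebra L) (h : A -> B) (e : nat -> A) (phi : formula L) :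
  embedding h -> qf phi -> sat (h \o e) phi <-> sat e phi.
Proof.
move=> hE.
elim: phi => //= [s t _|p IH /IH|p IHp q IHq []|p IHp q IHq []|p IHp q IHq []];
  [|by tauto|by move=> /IHp ? /IHq; tauto..].
by rewrite !eval_embedding //; split=> [/(proj1 hE)|->].
Qed.

(** The constant symbol supplies an element; it serves as a default value in later choices. *)
Lemma algebra_inhabited (A : algebra L) : inhabited A.
Proof. by split; apply: (op (f := csym L)); rewrite csym_const; exact: [tuple]. Qed.

End Satisfaction.

(** * Reduced products *)

(* The class of a family modulo the filter [F] is encoded by the family itself,
   once a representative of each class has been chosen. *)
Section ReducedProduct.
Variables (L : lang) (I : Type) (A : I -> algebra L).
Variables (F : set_system I).
Context {FF : ProperFilter F}.

Definition eqF (a b : forall i, A i) : Prop := F (fun i => a i = b i).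

Lemma eqF_refl a : eqF a a.
Proof. exact: filterE. Qed.

Lemma eqF_sym a b : eqF a b -> eqF b a.
Proof. by apply: filterS => i ->. Qed.

Lemma eqF_trans b a c : eqF a b -> eqF b c -> eqF a c.
Proof. by apply: filterS2 => i -> ->. Qed.

Definition canon (a : forall i, A i) : forall i, A i :=
  sval (cid (ex_intro (eqF a) a (eqF_refl a))).

Lemma canonP a : eqF a (canon a).
Proof. exact: (proj2_sig (cid (ex_intro (eqF a) a (eqF_refl a)))). Qed.

(** Equivalent families have extensionally equal classes, and by proof irrelevance the choice
    operator returns the same representative for equal predicates. *)
Lemma canon_eq a b : eqF a b -> canon a = canon b.
Proof.
have cid_ext (P Q : (forall i, A i) -> Prop) (p : ex P) (q : ex Q) :
    P = Q -> sval (cid p) = sval (cid q).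
  by move=> PQ; case: _ / PQ q => q; rewrite (Prop_irrelevance p q).
move=> ab; apply: cid_ext.
by apply/funext => c; apply/propext; split; apply: eqF_trans => //; exact: eqF_sym.
Qed.

Definition prod_carrier := {a : forall i, A i | canon a = a}.

Definition cls (a : forall i, A i) : prod_carrier :=
  exist _ (canon a) (canon_eq (eqF_sym (canonP a))).

Lemma cls_eq a b : cls a = cls b <-> eqF a b.
Proof.
split=> [[ab]|/canon_eq ab]; last exact/eq_exist.
by apply: (eqF_trans (canonP a)); rewrite ab; exact/eqF_sym/canonP.
Qed.

Lemma clsK (x : prod_carrier) : cls (sval x) = x.
Proof. by case: x => a ca; exact/eq_exist. Qed.

Definition redprod : algebra L :=
  @Algebra L prod_carrier
    (fun f args => cls (fun i => op (map_tuple (fun x => sval x i) args))).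

(** Arities are finite, so the sets on which each argument agrees with its chosen representative
    have their intersection in [F]. *)
Lemma op_cls (f : Defs.fsym L) (g : 'I_(arity f) -> forall i, A i) :
  op (a := redprod) (mktuple (fun j => cls (g j))) =
  cls (fun i => op (mktuple (fun j => g j i))).
Proof.
apply/cls_eq; have : F (fun i => forall j, g j i = sval (cls (g j)) i).
  by apply: filter_forall => j; exact: canonP.
apply: filterS => i gi; congr op; apply: eq_from_tnth => j.
by rewrite tnth_map !tnth_mktuple.
Qed.

Lemma op_map_cls (f : Defs.fsym L) (X : Type) (g : X -> forall i, A i)
    (args : (arity f).-tuple X) :
  op (a := redprod) (map_tuple (fun x => cls (g x)) args) =
  cls (fun i => op (map_tuple (fun x => g x i) args)).
Proof.
have mapE Y (k : X -> Y) : map_tuple k args = mktuple (fun j => k (tnth args j)).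
  by apply: eq_from_tnth => j; rewrite tnth_mktuple tnth_map.
rewrite mapE op_cls; congr cls; apply: functional_extensionality_dep => i.
by rewrite mapE.
Qed.

Lemma eval_redprod (e : nat -> forall i, A i) (t : term L) :
  eval (A := redprod) (fun n => cls (e n)) t =
  cls (fun i => eval (fun n => e n i) t).
Proof.
elim: t => [n|f ts IH] //; apply: etrans (op_cls _).
by apply: (congr1 (op (a := redprod) (f := f))); exact: eq_mktuple.
Qed.

Lemma redprod_env (e : nat -> redprod) :
  exists e' : nat -> forall i, A i, e = fun n => cls (e' n).
Proof. by exists (fun n => sval (e n)); apply/funext => n; rewrite clsK. Qed.

End ReducedProduct.

Arguments cls {L I A} F {FF} a.
Arguments redprod {L I} A F {FF}.

(** * Ultraproducts and the theorem of Łoś *)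

Lemma ultra_not I (U : set_system I) {UU : UltraFilter U} (P : set I) :
  ~ U P -> U (fun i => ~ P i).
Proof. by move=> UnP; have [] := in_ultra_setVsetC P UU. Qed.

Lemma filter_not I (F : set_system I) {FF : ProperFilter F} (P : set I) :
  F (fun i => ~ P i) -> ~ F P.
Proof. by move=> UN UP; have [i []] := filter_ex (filterI UN UP). Qed.

Lemma ultra_iff I (U : set_system I) {UU : UltraFilter U} (P Q : set I) :
  (U P <-> U Q) <-> U (fun i => P i <-> Q i).
Proof.
split=> [|h]; last first.
  by split; move: h; apply: filterS2 => i; tauto.
have [UP|UP] := pselect (U P) => PQ.
  by move: UP (proj1 PQ UP); apply: filterS2 => i; tauto.
have UQ : ~ U Q by tauto.
have nP : U (fun i => ~ P i) by exact: ultra_not.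
have nQ : U (fun i => ~ Q i) by exact: ultra_not.
by move: nP nQ; apply: filterS2 => i; tauto.
Qed.

Section Ultraproduct.
Variables (L : lang) (I : Type) (A : I -> algebra L).
Variables (U : set_system I).
Context {UU : UltraFilter U}.

Lemma upd_cls (d : nat -> forall i, A i) x a :
  upd (fun n => cls U (d n)) x (cls U a) = fun n => cls U (upd d x a n).
Proof. by apply/funext => v; rewrite /upd; case: eqP. Qed.

Lemma upd_family (d : nat -> forall i, A i) x a i :
  (fun n => upd d x a n i) = upd (fun n => d n i) x (a i).
Proof. by apply/funext => v; rewrite /upd; case: eqP. Qed.

(** Chooses witnesses in all coordinates at once, with an arbitrary value where no witness
    exists. *)
Lemma epsilons (P : forall i, A i -> Prop) :
  exists f : forall i, A i, forall i, (exists b, P i b) -> P i (f i).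
Proof.
have h i : exists b : A i, (exists c, P i c) -> P i b.
  have [[c Pc]|np] := pselect (exists c, P i c); first by exists c.
  by have [b] := algebra_inhabited (A i); exists b.
by exists (fun i => sval (cid (h i))) => i; case: (cid (h i)).
Qed.

Theorem los (phi : formula L) (e : nat -> forall i, A i) :
  sat (A := redprod A U) (fun n => cls U (e n)) phi <->
  U (fun i => sat (fun n => e n i) phi).
Proof.
elim: phi e => [s t|p IH|p IHp q IHq|p IHp q IHq|p IHp q IHq|x p IH|x p IH] e.
- by rewrite /= !eval_redprod; exact: cls_eq.
- by rewrite [X in X <-> _]/= IH; split=> [/ultra_not|/filter_not].
- rewrite /= IHp IHq; split=> [[]|h]; first exact: filterI.
  by split; apply: filterS h => i [].
- rewrite /= IHp IHq; split=> [[]|h];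
    [by apply: filterS; left|by apply: filterS; right|].
  have [Up|/ultra_not np] := pselect (U (fun i => sat (fun n => e n i) p)).
    by left.
  by right; move: np h; apply: filterS2 => i np [].
- rewrite /= IHp IHq; split=> [h|h Up]; last by apply: filter_app Up.
  have [/h|/ultra_not] := pselect (U (fun i => sat (fun n => e n i) p)).
    by apply: filterS => i ? /=.
  by apply: filterS => i ? /=.
- rewrite /=; split=> [h|h a].
    (* [f] is a counterexample in each coordinate that has one; where [p] holds of [f i] it
       therefore holds of every element. *)
    have [f fP] := epsilons (fun i b => ~ sat (upd (fun n => e n i) x b) p).
    have := h (cls U f); rewrite upd_cls IH; apply: filterS => i; rewrite upd_family.
    by move=> pf b; apply: contrapT => npb; apply: (fP i) pf; exists b.
  rewrite -[a]clsK upd_cls IH; apply: filterS h => i /(_ (sval a i)).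
  by rewrite upd_family.
- rewrite /=; split=> [[a]|h].
    rewrite -[a]clsK upd_cls IH; apply: filterS => i; rewrite upd_family.
    by exists (sval a i).
  have [f fP] := epsilons (fun i b => sat (upd (fun n => e n i) x b) p).
  exists (cls U f); rewrite upd_cls IH; apply: filterS h => i /fP.
  by rewrite upd_family.
Qed.

End Ultraproduct.

(** * Closure properties of universal classes *)

Section UniversalClasses.
Variable L : lang.

Lemma holds_Fall (A : algebra L) x (phi : formula L) :
  holds A (Fall x phi) <-> holds A phi.
Proof.
split=> [h e|h e a]; last exact: h.
by have := h e (e x); rewrite upd_id.
Qed.

Lemma universal_embedding (A B : algebra L) (h : A -> B) (phi : formula L) :
  embedding h -> universal phi -> holds B phi -> holds A phi.
Proof.
move=> hE; elim: phi => [s t|p _|p _ q _|p _ q _|p _ q _|x p IH|//] U;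
  last by rewrite !holds_Fall; exact: IH.
all: by move=> H e; apply/(sat_embedding e hE U).
Qed.

Variable K : algebra L -> Prop.
Hypothesis KU : universal_class K.

Lemma universal_class_embedding (A B : algebra L) (h : A -> B) :
  embedding h -> K B -> K A.
Proof.
have [Sg [SgU SgP]] := KU; move=> hE /SgP KB; apply/SgP => phi Sphi.
exact: (universal_embedding hE (proj2 (SgU _ Sphi)) (KB _ Sphi)).
Qed.

Lemma is_model_redprod (T : theory L) I (A : I -> algebra L) (U : set_system I)
    (UU : UltraFilter U) :
  (forall i, is_model T (A i)) -> is_model T (redprod A U).
Proof.
move=> TA phi Tphi e; have [d ->] := redprod_env e.
by apply/los; apply: filterE => i; exact: TA.
Qed.

Lemma universal_class_redprod I (A : I -> algebra L) (U : set_system I)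
    (UU : UltraFilter U) :
  (forall i, K (A i)) -> K (redprod A U).
Proof.
have [Sg [_ SgP]] := KU; move=> KA; apply/SgP/is_model_redprod => i.
exact/SgP.
Qed.

Lemma is_model_Th (A : algebra L) : is_model (Th K) A <-> K A.
Proof.
have [Sg [SgU SgP]] := KU; split=> [TA|KA phi [_]]; last exact.
apply/SgP => phi Sphi; apply: TA; split; first exact: (proj1 (SgU _ Sphi)).
by move=> B /SgP; apply.
Qed.

End UniversalClasses.

(** The form of compactness used throughout: if the factor at [l] meets the demands listed in [l],
    then the ultraproduct meets every demand. The type [{classic P}] provides the decidable equality
    behind [\in]. *)
Lemma cofinal_ultrafilter (P : Type) :
  exists U : set_system (seq {classic P}),
    UltraFilter U /\ forall p, U (fun l => p \in l).
Proof.
(* The filter generated by the cones above single lists; it is proper since [l] lies in its own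
   cone. *)
pose F (S : set (seq {classic P})) := exists l : seq {classic P},
  forall l' : seq {classic P}, {subset l <= l'} -> S l'.
have FF : ProperFilter F.
  split; first by case=> l /(_ l); apply.
  split=> [|S1 S2 [l1 h1] [l2 h2]|S1 S2 S12 [l h]]; first by exists [::].
    by exists (l1 ++ l2) => l' ll'; split; [apply: h1|apply: h2] => x xl;
      apply: ll'; rewrite mem_cat xl ?orbT.
  by exists l => l' /h /S12.
have [U [UU FU]] := ultraFilterLemma FF; exists U; split=> // p.
by apply: FU; exists [:: p] => l'; apply; rewrite inE.
Qed.

(** * Variables of terms *)

Section Terms.
Variable L : lang.

Lemma fv_cterm : fv_term (cterm L) = [::].
Proof.
rewrite /=; suff -> : enum 'I_(arity (csym L)) = [::] by [].
by apply: size0nil; rewrite size_enum_ord csym_const.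
Qed.

Lemma fv_Ftop : fv (Ftop L) = [::].
Proof. by rewrite -[LHS]/(fv_term (cterm L) ++ fv_term (cterm L)) fv_cterm. Qed.

Lemma fv_app (f : Defs.fsym L) (ts : 'I_(arity f) -> term L) (xs : seq nat) :
  {subset fv_term (App f ts) <= xs} <-> forall i, {subset fv_term (ts i) <= xs}.
Proof.
split=> [h i x xi|h x /flatten_mapP[i _]]; last exact: h.
by apply: h; apply/flatten_mapP; exists i; rewrite ?mem_enum.
Qed.

Lemma sub_cat (s1 s2 xs : seq nat) :
  {subset s1 ++ s2 <= xs} <-> {subset s1 <= xs} /\ {subset s2 <= xs}.
Proof.
split=> [h|[h1 h2] x]; last by rewrite mem_cat => /orP[/h1|/h2].
by split=> x xs'; apply: h; rewrite mem_cat xs' ?orbT.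
Qed.

End Terms.

(** * The subalgebra generated by a tuple *)

Section CommonSubalgebra.
Variables (L : lang) (M N : algebra L) (xs : seq nat) (e : nat -> M) (e' : nat -> N).
Hypothesis same_eqs : forall s t : term L, {subset fv (Feq s t) <= xs} ->
  sat e (Feq s t) <-> sat e' (Feq s t).

Let gen_carrier := {m : M | exists t, {subset fv_term t <= xs} /\ eval e t = m}.

Let el t (ht : {subset fv_term t <= xs}) : gen_carrier :=
  exist _ (eval e t) (ex_intro _ t (conj ht erefl)).

Let tm (a : gen_carrier) : term L := sval (cid (proj2_sig a)).

Let tm_fv a : {subset fv_term (tm a) <= xs}.
Proof. exact: (proj1 (proj2_sig (cid (proj2_sig a)))). Qed.

Let tm_eval a : eval e (tm a) = sval a.
Proof. exact: (proj2 (proj2_sig (cid (proj2_sig a)))). Qed.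

Let el_tm a : el (@tm_fv a) = a.
Proof. by case: a (tm_eval a) => m hm /= te; exact/eq_exist. Qed.

Let app_fv (f : Defs.fsym L) (args : (arity f).-tuple gen_carrier) :
  {subset fv_term (App f (fun i => tm (tnth args i))) <= xs}.
Proof. by apply/fv_app => i; exact: tm_fv. Qed.

Let gen_alg : algebra L := @Algebra L gen_carrier (fun f args => el (@app_fv f args)).

(** The elements of [M] that are values of terms over [xs] form the algebra [gen_alg], and [tm]
    picks a term for each. Sending the value of a term under [e] to its value under [e'] is well
    defined and injective exactly because the two assignments satisfy the same equations. *)
Lemma common_subalgebra :
  exists (A : algebra L) (i : A -> M) (j : A -> N) (d : nat -> A),
    [/\ embedding i, embedding j,
        generated (fun a => exists2 x, x \in xs & a = d x) &
        {in xs, forall x, i (d x) = e x /\ j (d x) = e' x}].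
Proof.
have eqvP s t : {subset fv_term s <= xs} -> {subset fv_term t <= xs} ->
    eval e s = eval e t <-> eval e' s = eval e' t.
  by move=> hs ht; apply: same_eqs; apply/sub_cat.
(* Outside [xs] the assignment takes the value of the constant, which always lies in the generated
   subalgebra. *)
pose v x : term L := if x \in xs then Var x else cterm L.
have v_fv x : {subset fv_term (v x) <= xs}.
  rewrite /v; case: ifP => xxs y; last by rewrite fv_cterm.
  by rewrite inE => /eqP->.
pose j (a : gen_alg) := eval e' (tm a).
have jel t (ht : {subset fv_term t <= xs}) : j (el ht) = eval e' t.
  by apply/eqvP; rewrite ?tm_eval //; exact: tm_fv.
exists gen_alg, (fun a => sval a), j, (fun x => el (@v_fv x)); split.
- split=> [a b ab|f args /=].
    by rewrite -[a]el_tm -[b]el_tm; apply: eq_exist; rewrite !tm_eval.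
  congr op; apply: eq_from_tnth => i; rewrite tnth_mktuple tnth_map; exact: tm_eval.
- split=> [a b /(eqvP _ _ (@tm_fv a) (@tm_fv b))|f args].
    rewrite !tm_eval => ab.
    by rewrite -[a]el_tm -[b]el_tm; apply: eq_exist; rewrite !tm_eval.
  rewrite [LHS]jel /=; congr op; apply: eq_from_tnth => i.
  by rewrite tnth_mktuple tnth_map.
- move=> S S0 Sop a; rewrite -[a]el_tm; move: (tm a) (@tm_fv a).
  elim=> [x|f ts IH] ht.
    apply: S0; have xxs : x \in xs by apply: ht; rewrite inE.
    by exists x => //; apply: eq_exist; rewrite /v xxs.
  have hts := proj1 (fv_app ts xs) ht.
  have -> : el ht = op (a := gen_alg) (mktuple (fun i => el (hts i))).
    apply: eq_exist => /=; congr op; apply: eq_mktuple => i.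
    by rewrite tm_eval tnth_mktuple.
  by apply: Sop => i; rewrite tnth_mktuple.
- by move=> x xxs; rewrite jel /= /v xxs.
Qed.

End CommonSubalgebra.

(** * Quantifier-free definability by compactness *)

Section QuantifierElimination.
Variable L : lang.

Implicit Types (P C : forall A : algebra L, (nat -> A) -> Prop) (xs : seq nat).

(** Induction on [F]: the context [C] is split according to the truth of the first equation, and the
    two formulas obtained are glued by cases. When no equation is left, [P] is constant on [C]. *)
Lemma definable_of_equations C P xs (F : seq {classic Defs.eqn L}) :
  {in F, forall q, {subset fv (Feq q.1 q.2) <= xs}} ->
  (forall (A B : algebra L) (e : nat -> A) (e' : nat -> B), C A e -> C B e' ->
     {in F, forall q, sat e (Feq q.1 q.2) <-> sat e' (Feq q.1 q.2)} ->
     P A e -> P B e') ->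
  exists chi : formula L, [/\ qf chi, {subset fv chi <= xs} &
    forall (A : algebra L) (e : nat -> A), C A e -> P A e <-> sat e chi].
Proof.
elim: F C => [|q F IH] C Fxs FP.
  have [[A [e [CA PA]]]|nP] :=
    pselect (exists (A : algebra L) (e : nat -> A), C A e /\ P A e).
    exists (Ftop L); split=> //; first by rewrite fv_Ftop.
    by move=> B e' CB; split=> // _; apply: (FP _ _ _ _ CA CB).
  exists (Fnot (Ftop L)); split=> //; first by rewrite -[fv _]/(fv (Ftop L)) fv_Ftop.
  move=> B e' CB; split=> [PB|/(_ erefl)//].
  by case: nP; exists B, e'.
have Fxs' : {in F, forall q, {subset fv (Feq q.1 q.2) <= xs}}.
  by move=> r rF; apply: Fxs; rewrite inE rF orbT.
pose Q (A : algebra L) (e : nat -> A) := sat e (Feq q.1 q.2).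
have [||c1 [q1 f1 h1]] := IH (fun A e => C A e /\ Q A e) => //.
  move=> A B e e' [CA QA] [CB QB] AB; apply: FP => // r; rewrite inE.
  by case/predU1P => [->|/AB].
have [||c2 [q2 f2 h2]] := IH (fun A e => C A e /\ ~ Q A e) => //.
  move=> A B e e' [CA QA] [CB QB] AB; apply: FP => // r; rewrite inE.
  by case/predU1P => [->|/AB].
have qxs : {subset fv (Feq q.1 q.2) <= xs} by apply: Fxs; rewrite inE eqxx.
exists (For (Fand (Feq q.1 q.2) c1) (Fand (Fnot (Feq q.1 q.2)) c2)); split=> //.
  by apply/sub_cat; split; apply/sub_cat.
move=> A e CA /=; have [QA|QA] := pselect (Q A e).
  by rewrite (h1 A e) //; rewrite /Q /= in QA; tauto.
by rewrite (h2 A e) //; rewrite /Q /= in QA; tauto.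
Qed.

(** Otherwise each finite list of equations admits two models of [T] that agree on it and disagree
    on [phi]. The two ultraproducts along a cofinal ultrafilter then agree on all equations over
    [xs] and still disagree on [phi]. *)
Lemma qf_of_type_determined (T : theory L) xs (phi : formula L) :
  (forall (M N : algebra L) (e : nat -> M) (e' : nat -> N),
     is_model T M -> is_model T N ->
     (forall s t : term L, {subset fv (Feq s t) <= xs} ->
        sat e (Feq s t) <-> sat e' (Feq s t)) ->
     sat e phi -> sat e' phi) ->
  exists chi : formula L, [/\ qf chi, {subset fv chi <= xs} &
    forall (M : algebra L) (e : nat -> M), is_model T M -> sat e phi <-> sat e chi].
Proof.
move=> det; apply: contrapT => nochi.
(* The index lists range over all equations; only those over [xs] can be asked to agree. *)
pose over (F : seq {classic Defs.eqn L}) : seq {classic Defs.eqn L} :=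
  [seq q <- F | all (mem xs) (fv (Feq q.1 q.2))].
have bad (F : seq {classic Defs.eqn L}) : exists p : {M : algebra L & nat -> M} *
    {M : algebra L & nat -> M},
    [/\ is_model T (projT1 p.1) /\ is_model T (projT1 p.2),
       {in over F, forall q,
         sat (projT2 p.1) (Feq q.1 q.2) <-> sat (projT2 p.2) (Feq q.1 q.2)},
       sat (projT2 p.1) phi & ~ sat (projT2 p.2) phi].
  apply: contrapT => nobad; apply: nochi.
  apply: (@definable_of_equations (fun A _ => is_model T A)
    (fun A e => sat e phi) xs (over F)).
    by move=> q; rewrite mem_filter => /andP[/allP].
  move=> A B e e' TA TB AB Ae; apply: contrapT => Be; apply: nobad.
  by exists (existT _ A e, existT _ B e').
have [p pP] := choice bad.
have [U [UU Uin]] := cofinal_ultrafilter (Defs.eqn L).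
pose M i := projT1 (p i).1; pose N i := projT1 (p i).2.
pose eM n : forall i, M i := fun i => projT2 (p i).1 n.
pose eN n : forall i, N i := fun i => projT2 (p i).2 n.
have /los : sat (A := redprod N U) (fun n => cls U (eN n)) phi.
  apply: (det (redprod M U) (redprod N U) (fun n => cls U (eM n))).
  - by apply: is_model_redprod => i; have [[]] := pP i.
  - by apply: is_model_redprod => i; have [[]] := pP i.
  - move=> s t stxs.
    apply: iff_trans (los (A := M) _ _) (iff_trans _ (iff_sym (los (A := N) _ _))).
    apply/ultra_iff; move: (Uin (s, t)); apply: filterS => i sti.
    have [_ + _ _] := pP i; move/(_ (s, t)); apply; rewrite mem_filter sti andbT.
    by apply/allP.
  - by apply/los; apply: filterE => i; have [] := pP i.
by apply: filter_not; apply: filterE => i; have [] := pP i.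
Qed.

End QuantifierElimination.

(** * Conjunctions of literals and existential prefixes *)

Section Literals.
Variable L : lang.

Lemma qf_conj_eqs (es : seq (Defs.eqn L)) : qf (conj_eqs es).
Proof. by elim: es. Qed.

Lemma qf_conj_lits (ls : seq (lit L)) : qf (conj_lits ls).
Proof. by elim: ls => //= -[[] q] ls. Qed.

(** Turns a prescribed pattern of truth values on finitely many equations into a system of
    literals. *)
Lemma sat_complete_lits (A : algebra L) (e : nat -> A) (P : Defs.eqn L -> Prop)
    (es : seq {classic Defs.eqn L}) :
  sat e (conj_lits [seq (`[<P q>], q) : lit L | q <- es]) <->
  {in es, forall q, sat e (Feq q.1 q.2) <-> P q}.
Proof.
elim: es => [|q es IH]; first by split.
have qP : sat e (lit_form (`[<P q>], q)) <-> (sat e (Feq q.1 q.2) <-> P q).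
  by rewrite /lit_form; case: asboolP => Pq /=; tauto.
split=> [[/qP ? /IH h] r|h]; first by rewrite inE => /predU1P[->|/h].
split; first by apply/qP/h; rewrite inE eqxx.
by apply/IH => r rs; apply: h; rewrite inE rs orbT.
Qed.

Lemma sat_Fexs (A : algebra L) (phi : formula L) (vs : seq nat) (e : nat -> A) :
  sat e (foldr (@Fex L) phi vs) <->
  exists2 e', (forall v, v \notin vs -> e' v = e v) & sat e' phi.
Proof.
elim: vs e => [|x vs IH] e.
  split=> [h|[e' /= ee' h]]; first by exists e.
  by rewrite (_ : e = e') //; apply/funext => v; rewrite ee'.
split=> [[a /IH[e' ee' h]]|[e' ee' h]].
  exists e' => // v; rewrite inE negb_or => /andP[vx /ee'->].
  by rewrite upd_other.
exists (e' x); apply/IH; exists e' => // v vvs; rewrite /upd.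
by case: (eqVneq v x) => [->//|vx]; apply: ee'; rewrite inE negb_or vx.
Qed.

End Literals.

Lemma diagonal_embedding (L : lang) (A : algebra L) I (B : I -> algebra L)
    (h : forall i, A -> B i) (F : set_system I) {FF : ProperFilter F} :
  (forall i, embedding (h i)) ->
  embedding (fun a => cls F (fun i => h i a) : redprod B F).
Proof.
move=> hE; split=> [a b /cls_eq/filter_ex[i /(proj1 (hE i))]//|f args].
apply: etrans (esym (op_map_cls _ _)); congr cls.
by apply: functional_extensionality_dep => i; exact: (proj2 (hE i)).
Qed.

(** * From a model completion to the three properties *)

Section ModelCompletion.
Variables (L : lang) (K : algebra L -> Prop) (KU : universal_class K).
Variables (Ts : theory L) (mc : model_completion (Th K) Ts).

Lemma completion_model_in_class M : is_model Ts M -> K M.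
Proof.
have [_ [_ [univ _]]] := mc; have [Sg [SgU SgP]] := KU.
move=> TM; apply/SgP => phi Sphi; have [sphi uphi] := SgU _ Sphi.
apply: (proj1 (univ _ sphi uphi) _ M TM) => A; apply; split=> // B /SgP; exact.
Qed.

Lemma completion_extension A : K A ->
  exists (N : algebra L) (h : A -> N), is_model Ts N /\ embedding h.
Proof.
have [_ [_ [_ diag]]] := mc; move=> KA.
by have [] := diag A (proj2 (is_model_Th KU A) KA).
Qed.

(** [A] inherits membership in [K] from [N], so its diagram together with [Ts] is complete and
    decides [phi] uniformly in all extensions that are models of [Ts]. *)
Lemma completion_transfer (A N N' : algebra L) (h : A -> N) (h' : A -> N')
    (phi : formula L) (e : nat -> A) :
  is_model Ts N -> is_model Ts N' -> embedding h -> embedding h' ->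
  sat (h \o e) phi -> sat (h' \o e) phi.
Proof.
move=> TN TN' hE hE' h0; have [_ [_ [_ diag]]] := mc.
have TA : is_model (Th K) A.
  by apply/(is_model_Th KU)/(universal_class_embedding KU hE)/completion_model_in_class.
have [_ /(_ phi e)[h1|h1]] := diag A TA; first exact: h1.
by case: (h1 N h TN hE).
Qed.

Lemma completion_qe (phi : formula L) :
  exists chi : formula L, [/\ qf chi, {subset fv chi <= fv phi} &
    forall (M : algebra L) (e : nat -> M), is_model Ts M -> sat e phi <-> sat e chi].
Proof.
apply: qf_of_type_determined => M N e e' TM TN ee'.
have [A [i [j [d [iE jE _ ij]]]]] := common_subalgebra ee'.
have di : sat (i \o d) phi <-> sat e phi by apply: sat_ext => x /ij[].
have dj : sat (j \o d) phi <-> sat e' phi by apply: sat_ext => x /ij[].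
move=> /di h; apply/dj; exact: (completion_transfer TM TN iE jE).
Qed.

(** [chi] eliminates the quantifier of [exists y, psi] in models of [Ts]. Every member of [K] embeds
    in such a model, and quantifier-free formulas pass both ways along the embedding. *)
Lemma completion_solvability (xs : seq nat) (y : nat) (psi : formula L) :
  {subset fv psi <= y :: xs} -> qf psi ->
  exists chi : formula L, [/\ qf chi, {subset fv chi <= xs},
    Kmodels K (Fimp psi chi) &
    forall (A : algebra L) (e : nat -> A), K A -> sat e chi ->
    exists (B : algebra L) (h : A -> B) (b : B),
      [/\ K B, embedding h & sat (upd (h \o e) y b) psi]].
Proof.
move=> psixs qpsi; have [chi [qchi chixs chiP]] := completion_qe (Fex y psi).
exists chi; split=> //.
- move=> x /chixs /=; rewrite mem_filter /= => /andP[xy /psixs].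
  by rewrite inE (negPf xy).
- move=> A KA e /= epsi; have [N [h [TN hE]]] := completion_extension KA.
  apply/(sat_embedding e hE qchi)/chiP => //.
  by exists (h (e y)); rewrite -upd_comp upd_id; apply/sat_embedding.
move=> A e KA echi; have [N [h [TN hE]]] := completion_extension KA.
have /chiP[//|b psib] : sat (h \o e) chi by apply/sat_embedding.
by exists N, h, b; split=> //; exact: completion_model_in_class.
Qed.

(** An equational consequence of [es] holds at the solution found in an extension; as it does not
    mention [y], it descends to [A]. *)
Lemma completion_variable_projection : variable_projection K.
Proof.
move=> xs y es yxs esxs.
have [xi [qxi xixs Kxi xiP]] := completion_solvability esxs (qf_conj_eqs es).
exists xi; do 3!split=> //; move=> s t stxs Kst A KA e.
move=> /(xiP _ _ KA)[B [h [b [KB hE hb]]]].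
apply/(sat_embedding (phi := Feq s t) e hE) => //.
have := Kst B KB _ hb; apply: (iffLR (sat_ext (phi := Feq s t) _)) => x /stxs xxs.
by rewrite upd_other //; apply: contraNneq yxs => <-.
Qed.

Lemma completion_conservative_extension : conservative_model_extension K.
Proof.
move=> xs y ls yxs lsxs.
have [chi [qchi chixs Kchi chiP]] := completion_solvability lsxs (qf_conj_lits ls).
exists chi; do 3!split=> //; move=> A e KA _ echi _.
by have [B [h [b []]]] := chiP A e KA echi; exists B, h, b.
Qed.

(* Finitely many facts about [C] are expressed by an existential formula with
   parameters in [A], so they transfer from [N'] to [N]. *)
Lemma completion_reflection (A C N N' : algebra L) (g : A -> C) (h : A -> N)
    (h' : C -> N') (es : seq {classic Defs.eqn L}) (c : nat -> C) :
  is_model Ts N -> is_model Ts N' -> embedding g -> embedding h -> embedding h' ->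
  exists b : nat -> N,
    {in es, forall q, sat b (Feq q.1 q.2) <-> sat c (Feq q.1 q.2)} /\
    forall v a, c v = g a -> b v = h a.
Proof.
move=> TN TN' gE hE hE'; have [a0] := algebra_inhabited A.
(* [d] names by a parameter in [A] each value of [c] that comes from [A]; the variables of [phi]
   with other values, collected in [vs], are quantified existentially. *)
have /choice[d dP] : forall v, exists a, (exists a', c v = g a') -> c v = g a.
  move=> v; have [[a ca]|na] := pselect (exists a', c v = g a'); first by exists a.
  by exists a0.
pose phi := conj_lits [seq (`[<sat c (Feq q.1 q.2)>], q) : lit L | q <- es].
pose vs := [seq v <- fv phi | ~~ `[<exists a, c v = g a>]].
have : sat ((h' \o g) \o d) (foldr (@Fex L) phi vs).
  apply/sat_Fexs; exists (fun v => if v \in vs then h' (c v) else h' (g (d v))).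
    by move=> v /negPf->.
  have : sat (h' \o c) phi.
    by apply/sat_embedding => //; [exact: qf_conj_lits|apply/sat_complete_lits].
  apply: (iffLR (sat_ext _)) => v vphi /=; case: ifPn => //.
  by rewrite mem_filter vphi andbT negbK => /asboolP/dP->.
move/(completion_transfer TN' TN (embedding_comp gE hE') hE).
move/sat_Fexs => [e eh ephi].
exists (fun v => if `[<exists a, c v = g a>] then h (d v) else e v); split.
  apply/(sat_complete_lits _ (fun q => sat c (Feq q.1 q.2))).
  apply: (iffLR (sat_ext _)) ephi => v vphi; case: ifPn => // cv.
  by rewrite eh // mem_filter cv.
move=> v a ca; have cv : exists a, c v = g a by exists a.
by rewrite asboolT //; congr h; apply: (proj1 gE); rewrite -dP.
Qed.

(** The amalgam is an ultrapower of [N], a model above [B]. There [B] sits diagonally, and [C] is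
    embedded by gluing the reflections of finitely many facts at a time. *)
Lemma completion_amalgamation : amalgamation K.
Proof.
move=> A B C f g KA KB KC fE gE.
have [N [hB [TN hBE]]] := completion_extension KB.
have [N' [hC [TN' hCE]]] := completion_extension KC.
have [c0] := algebra_inhabited C.
(* In the factor at [i], an element of [C] is represented by the variable numbered by its position
   in the list [l i]. An equation about elements of [C] is therefore a function of that list. *)
pose fact := (C * (seq {classic C} -> Defs.eqn L))%type.
pose l (i : seq {classic fact}) : seq {classic C} := [seq p.1 | p <- i].
pose es (i : seq {classic fact}) : seq {classic Defs.eqn L} := [seq p.2 (l i) | p <- i].
have refl i := completion_reflection (es i) (fun v => nth c0 (l i) v) TN TN' gE
  (embedding_comp fE hBE) hCE.
have [b bP] := choice refl.
have [U [UU Uin]] := cofinal_ultrafilter fact.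
have in_l (p : fact) i : (p : {classic fact}) \in i -> (p.1 : {classic C}) \in l i.
  exact: map_f.
have transfer E i x : ((x, E) : {classic fact}) \in i ->
    sat (b i) (Feq (E (l i)).1 (E (l i)).2) <->
    sat (fun v => nth c0 (l i) v) (Feq (E (l i)).1 (E (l i)).2).
  move=> xi; have [h _] := bP i; apply: h.
  exact: (map_f (fun p : {classic fact} => p.2 (l i) : {classic Defs.eqn L})) xi.
pose ix (x : C) (s : seq {classic C}) := index (x : {classic C}) s.
pose D := redprod (fun _ => N) U (FF := @ultra_proper _ U UU).
pose k (x : C) : D := cls U (fun i => b i (ix x (l i))).
have nth_ix x i : (x : {classic C}) \in l i -> nth c0 (l i) (ix x (l i)) = x.
  exact: nth_index.
exists D, (fun x => cls U (fun _ => hB x)), k; split.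
- by apply: universal_class_redprod => // i; exact: completion_model_in_class TN.
split; first exact: diagonal_embedding.
split; last first.
  (* The trivial equation only serves to put [g a] in the list. *)
  move=> a; apply/cls_eq; move: (Uin (g a, fun _ => (cterm L, cterm L))).
  apply: filterS => i /in_l ai; have [_ h] := bP i.
  by rewrite (h _ a) //; exact: nth_ix.
split=> [x x' /cls_eq kx|o args].
  pose E s : Defs.eqn L := (Var (ix x s), Var (ix x' s)).
  have [i [[xi xi'] bi]] := filter_ex (filterI (filterI (Uin (x, E)) (Uin (x', E))) kx).
  have /transfer[+ _] := xi; move=> /(_ bi) /=.
  by rewrite !nth_ix //; [exact: (in_l _ _ xi')|exact: (in_l _ _ xi)].
(* The equation saying that [o] sends [args] to [op args]. It is paired with each argument and with
   the value, so that all of them get a variable. *)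
pose E s : Defs.eqn L :=
  (App o (fun j => Var (ix (tnth args j) s)), Var (ix (op args) s)).
apply: etrans (esym (op_map_cls _ _)); apply/cls_eq.
have Uargs : U (fun i => forall j, ((tnth args j, E) : {classic fact}) \in i).
  by apply: filter_forall => j; exact: Uin.
move: (Uin (op args, E)) Uargs; apply: filterS2 => i oi argsi.
have /transfer[_] := oi; move=> /(_ _)/esym /= ->; last first.
  rewrite nth_ix; last exact: (in_l _ _ oi).
  congr op; apply: eq_from_tnth => j; rewrite tnth_mktuple nth_ix //.
  exact: (in_l _ _ (argsi j)).
by congr op; apply: eq_from_tnth => j; rewrite tnth_mktuple tnth_map.
Qed.

End ModelCompletion.

(** * Limits of omega-chains *)

Section DirectLimit.
Variables (L : lang) (A : nat -> algebra L) (h : forall n, A n -> A n.+1).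
Hypothesis hE : forall n, embedding (@h n).

(** Elements of the limit are represented by full families of which only the tail from stage [n] is
    constrained. *)
Definition coherent (s : forall n, A n) (n : nat) : Prop :=
  forall m, n <= m -> s m.+1 = h (s m).

Lemma coherent_agree s s' n m : coherent s n -> coherent s' n -> n <= m ->
  s m = s' m <-> s n = s' n.
Proof.
move=> cs cs'; elim: m => [|m IH]; first by rewrite leqn0 => /eqP->.
rewrite leq_eqVlt => /predU1P[->//|]; rewrite ltnS => nm.
by rewrite -(IH nm) cs // cs' //; split=> [/(proj1 (hE m))|->].
Qed.

Lemma coherent_leq s n m : coherent s n -> n <= m -> coherent s m.
Proof. by move=> cs nm k mk; apply: cs; exact: leq_trans mk. Qed.

End DirectLimit.

(** Induction on [n] for all chains at once: the chain is shifted by one stage, and stage zero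
    receives an arbitrary element. *)
Lemma coherent_thread (L : lang) (A : nat -> algebra L) (h : forall n, A n -> A n.+1)
    n (a : A n) :
  exists s : forall m, A m, s n = a /\ coherent h s n.
Proof.
elim: n A h a => [|n IH] A h a; first by exists (nat_rect _ a h).
have [s [sn cs]] := IH (fun m => A m.+1) (fun m => @h m.+1) a.
have [d] := algebra_inhabited (A 0).
exists (fun m => if m is k.+1 then s k else d); split=> // -[//|m] /cs.
exact.
Qed.

Section DirectLimitAlgebra.
Variables (L : lang) (K : algebra L -> Prop) (KU : universal_class K).
Variables (A : nat -> algebra L) (h : forall n, A n -> A n.+1).
Hypothesis KA : forall n, K (A n).
Hypothesis hE : forall n, embedding (@h n).

(* The limit of the chain is realised inside an ultraproduct of its members, as
   the subalgebra of the classes of eventually coherent sequences. *)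
Lemma direct_limit :
  exists (D : algebra L) (j : forall n, A n -> D),
    [/\ K D, forall n, embedding (j n),
        forall n a, j n.+1 (h a) = j n a &
        forall (xs : seq nat) (e : nat -> D), exists n (d : nat -> A n),
          {in xs, forall x, e x = j n (d x)}].
Proof.
have [U [UU UF]] := ultraFilterLemma eventually_filter.
have Uge n : U (fun m => n <= m) by apply: UF; exists n.
pose P := redprod (FF := @ultra_proper _ U UU) A U.
pose DT := {x : P | exists s n, coherent h s n /\ x = cls U s}.
have cls_coh s s' n m : coherent h s n -> coherent h s' n -> n <= m ->
    s m = s' m -> cls U s = cls U s'.
  move=> cs cs' nm ss'; apply/cls_eq; move: (Uge n); apply: filterS => k nk.
  by apply/(coherent_agree hE cs cs' nk)/(coherent_agree hE cs cs' nm).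
have op_coh (f : Defs.fsym L) (args : (arity f).-tuple DT) :
    exists s n, coherent h s n /\ op (map_tuple sval args) = cls U s.
  have /choice[p pP] : forall i, exists p : (forall m, A m) * nat,
      coherent h p.1 p.2 /\ sval (tnth args i) = cls U p.1.
    by move=> i; case: (tnth args i) => x [s [n [cs xs]]]; exists (s, n).
  (* The result is coherent once all of its finitely many arguments are, hence the maximum. *)
  exists (fun m => op (mktuple (fun i => (p i).1 m))), (\max_i (p i).2); split.
    move=> m nm; rewrite (proj2 (hE m)); congr op; apply: eq_from_tnth => i.
    rewrite tnth_mktuple tnth_map tnth_mktuple; apply: (proj1 (pP i)).
    exact: leq_trans (leq_bigmax i) nm.
  rewrite -op_cls; congr op; apply: eq_from_tnth => i.
  by rewrite tnth_map tnth_mktuple; exact: (proj2 (pP i)).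
pose D := @Algebra L DT
  (fun f args => exist _ (op (map_tuple sval args)) (op_coh f args)).
have th n : {t : A n -> forall m, A m & forall a, t a n = a /\ coherent h (t a) n}.
  exact: (choice (@coherent_thread L A h n)).
pose t n := projT1 (th n).
have tn n a : t n a n = a by exact: (proj1 (projT2 (th n) a)).
have tc n a : coherent h (t n a) n by exact: (proj2 (projT2 (th n) a)).
pose j n (a : A n) : D :=
  exist _ (cls U (t n a)) (ex_intro _ (t n a) (ex_intro _ n (conj (@tc n a) erefl))).
have jP n s : coherent h s n -> sval (j n (s n)) = cls U s.
  by move=> cs; apply: (cls_coh _ _ n n).
have inj_sval (x y : D) : sval x = sval y -> x = y.
  by case: x y => x px [y py] /= xy; exact: eq_exist.
have lift n m (a : A n) : n <= m -> j m (t n a m) = j n a.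
  move=> nm; apply: inj_sval; rewrite (jP m (t n a)) //.
  exact: coherent_leq nm.
exists D, j; split.
- apply: (universal_class_embedding KU (A := D) (B := P) (h := fun x => sval x)).
    by split=> [x y|f args] //; exact: inj_sval.
  exact: universal_class_redprod.
- move=> n; split=> [a b /(congr1 sval)/cls_eq ab|f args].
    have [m [mn]] := filter_ex (filterI (Uge n) ab).
    by move/(coherent_agree hE (tc n a) (tc n b) mn); rewrite !tn.
  apply: inj_sval => /=.
  rewrite [RHS](_ : _ = op (map_tuple (fun a => cls U (t n a) : P) args)); last first.
    by congr op; apply: eq_from_tnth => i; rewrite !tnth_map.
  rewrite op_map_cls -(jP n (fun i => op (map_tuple (fun a => t n a i) args))) /=.
    congr (cls U (t n _)); congr op; apply: eq_from_tnth => i.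
    by rewrite tnth_map tn.
  move=> m nm; rewrite (proj2 (hE m)); congr op; apply: eq_from_tnth => i.
  by rewrite !tnth_map tc.
- move=> n a; apply: inj_sval; rewrite -(lift n n.+1 a) //=.
  by rewrite tc // tn.
(* Finitely many elements of the limit come from one stage, the maximum of the stages at which each
   of them appears. *)
elim=> [|x xs IH] e.
  by have [a] := algebra_inhabited (A 0); exists 0, (fun=> a).
have [n [d dP]] := IH e; have [s [m [cs exs]]] := proj2_sig (e x).
pose k := maxn n m.
exists k, (fun v => if v == x then s k else t n (d v) k) => v.
rewrite inE; case: eqP => [-> _|_ /= vxs]; last by rewrite lift ?leq_maxl ?dP.
by apply: inj_sval; rewrite jP //; apply: coherent_leq cs _; exact: leq_maxr.
Qed.

End DirectLimitAlgebra.

(** * Existentially closed members of the class *)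

Section ExistentiallyClosed.
Variables (L : lang) (K : algebra L -> Prop) (KU : universal_class K).
Hypothesis AP : amalgamation K.

Definition ext_solvable (A : algebra L) (ls : seq (lit L)) (y : nat) (e : nat -> A) :=
  exists (B : algebra L) (h : A -> B) (b : B),
    [/\ K B, embedding h & sat (upd (h \o e) y b) (conj_lits ls)].

(** One unknown at a time is what eliminating a single quantifier requires. *)
Definition ec (A : algebra L) : Prop :=
  K A /\ forall ls y (e : nat -> A), ext_solvable ls y e ->
    exists a, sat (upd e y a) (conj_lits ls).

Lemma solution_embedding (A B C : algebra L) (h : A -> B) (k : B -> C)
    (ls : seq (lit L)) y (e : nat -> A) b :
  embedding k -> sat (upd (h \o e) y b) (conj_lits ls) ->
  sat (upd ((k \o h) \o e) y (k b)) (conj_lits ls).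
Proof.
move=> kE hb; rewrite -[X in upd X]/(k \o (h \o e)) -upd_comp.
by apply/sat_embedding => //; exact: qf_conj_lits.
Qed.

(** Each solvable system has a solution in some extension of [A], which is amalgamated over [A] with
    the extension built for the rest of the list. *)
Lemma solve_finitely (A : algebra L)
    (l : seq {classic (seq (lit L) * nat * (nat -> A))}) :
  K A -> exists (B : algebra L) (h : A -> B), [/\ K B, embedding h &
    {in l, forall p, ext_solvable p.1.1 p.1.2 p.2 ->
      exists b, sat (upd (h \o p.2) p.1.2 b) (conj_lits p.1.1)}].
Proof.
move=> KA; elim: l => [|[[ls y] e] l [B [h [KB hE lP]]]].
  by exists A, id; split=> //; exact: embedding_id.
have [[C [g [c [KC gE gc]]]]|np] := pselect (ext_solvable ls y e); last first.
  by exists B, h; split=> // p; rewrite inE => /predU1P[->/np|/lP].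
have [D [u [v [KD [uE [vE uv]]]]]] := AP KA KB KC hE gE.
exists D, (u \o h); split=> //; first exact: embedding_comp.
move=> p; rewrite inE => /predU1P[-> _|/lP h' /h'[b hb]]; last first.
  by exists (u b); exact: solution_embedding.
exists (v c); rewrite (_ : u \o h = v \o g); first exact: solution_embedding.
by apply/funext => a; exact: uv.
Qed.

Lemma solve_all (A : algebra L) :
  K A -> exists (B : algebra L) (h : A -> B), [/\ K B, embedding h &
    forall ls y e, ext_solvable ls y e ->
      exists b, sat (upd (h \o e) y b) (conj_lits ls)].
Proof.
move=> KA; set fact := (seq (lit L) * nat * (nat -> A))%type.
pose Q (l : seq {classic fact}) (Bh : {B : algebra L & A -> B}) :=
  [/\ K (projT1 Bh), embedding (projT2 Bh) &
    {in l, forall p : fact, ext_solvable p.1.1 p.1.2 p.2 ->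
      exists b, sat (upd (projT2 Bh \o p.2) p.1.2 b) (conj_lits p.1.1)}].
have /choice[Bh BhP] : forall l, exists Bh, Q l Bh.
  by move=> l; have [B [h]] := solve_finitely l KA; exists (existT _ B h).
have [U [UU Uin]] := cofinal_ultrafilter fact.
pose B l := projT1 (Bh l); pose h l : A -> B l := projT2 (Bh l).
exists (redprod B U), (fun a => cls U (fun l => h l a)); split.
- by apply: universal_class_redprod => // l; have [] := BhP l.
- by apply: diagonal_embedding => l; have [] := BhP l.
move=> ls y e eP.
have [b bP] := epsilons (fun l (b : B l) => sat (upd (h l \o e) y b) (conj_lits ls)).
exists (cls U b).
rewrite (_ : _ \o e = fun n => cls U (fun l => h l (e n))) // upd_cls; apply/los.
move: (Uin (ls, y, e)); apply: filterS => l le; rewrite upd_family.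
by apply: bP; have [_ _ /(_ _ le)] := BhP l; apply.
Qed.

(** Iterating [solve_all] gives a chain with limit [D]. The finitely many parameters of a system
    over [D] lie in one stage; an extension of [D] also extends that stage, so the system is solved
    at the next one. *)
Lemma ec_extension (A : algebra L) : K A ->
  exists (E : algebra L) (h : A -> E), ec E /\ embedding h.
Proof.
move=> KA.
pose Q (B : algebra L) (Ch : {C : algebra L & B -> C}) :=
  [/\ K (projT1 Ch), embedding (projT2 Ch) & forall ls y e, ext_solvable ls y e ->
    exists c, sat (upd (projT2 Ch \o e) y c) (conj_lits ls)].
have GP (B : algebra L) : {Ch | K B -> Q B Ch}.
  apply: cid; have [KB|nK] := pselect (K B); last by exists (existT _ B id).
  by have [C [h hP]] := solve_all KB; exists (existT _ C h).
pose chain n := iter n (fun B => projT1 (sval (GP B))) A.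
pose h n : chain n -> chain n.+1 := projT2 (sval (GP (chain n))).
have Kc n : K (chain n).
  by elim: n => //= n IH; have [] := proj2_sig (GP (chain n)) IH.
have hE n : embedding (@h n) by have [] := proj2_sig (GP (chain n)) (Kc n).
have [D [j [KD jE jh jP]]] := direct_limit KU Kc hE.
exists D, (j 0); split; last exact: (jE 0).
split=> // ls y e [B [k [b [KB kE kb]]]].
have [n [d dP]] := jP (fv (conj_lits ls)) e.
have : ext_solvable ls y d.
  exists B, (k \o j n), b; split=> //; first exact: embedding_comp.
  move: kb; apply: (iffLR (sat_ext _)) => v vls; rewrite /upd; case: eqP => //= _.
  by rewrite dP.
have [_ _ sol] := proj2_sig (GP (chain n)) (Kc n); move=> /sol[c hc].
exists (j n.+1 c); move: (solution_embedding (jE n.+1) hc).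
apply: (iffLR (sat_ext _)) => v vls; rewrite /upd; case: eqP => //= _.
by rewrite dP //; exact: jh.
Qed.

(** * Axioms for existential closedness *)

Hypothesis VP : variable_projection K.
Hypothesis CE : conservative_model_extension K.

Lemma fv_lits_pos (ls : seq (lit L)) :
  {subset fv (lits_pos ls) <= fv (conj_lits ls)}.
Proof.
elim: ls => // -[[] q] ls IH x; rewrite /lits_pos /= !mem_cat -?orbA.
  by case/or3P => [->|->|/IH->]; rewrite ?orbT.
by move/IH ->; rewrite !orbT.
Qed.

Lemma sat_lits_pos (A : algebra L) (e : nat -> A) (ls : seq (lit L)) :
  sat e (conj_lits ls) -> sat e (lits_pos ls).
Proof. by elim: ls => // -[[] q] ls IH /= [? /IH]. Qed.

(** Let [S] be the subalgebra generated by the parameters. The formula [xi] ensures that [S]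
    satisfies the equational consequences of the positive part, so [chi] provides a solution in an
    extension of [S]; amalgamating it with [A] over [S] gives a solution over [A]. *)
Lemma solvability_condition (xs : seq nat) (y : nat) (ls : seq (lit L)) :
  y \notin xs -> {subset fv (conj_lits ls) <= y :: xs} ->
  exists theta : formula L, [/\ qf theta, {subset fv theta <= xs},
    Kmodels K (Fimp (conj_lits ls) theta) &
    forall (A : algebra L) (e : nat -> A), K A -> sat e theta -> ext_solvable ls y e].
Proof.
move=> yxs lsxs.
have posxs : {subset fv (lits_pos ls) <= y :: xs} by move=> x /fv_lits_pos/lsxs.
have [xi [qxi [xixs [Kxi xiP]]]] := VP yxs posxs.
have [chi [qchi [chixs [Kchi chiP]]]] := CE yxs lsxs.
exists (Fand chi xi); split=> //; first by apply/sub_cat.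
  by move=> A KA e els; split; [exact: Kchi|exact/(Kxi A KA)/sat_lits_pos].
move=> A e KA [echi exi].
(* Both assignments are taken to be [e], which yields the subalgebra it generates. *)
have [S [i [j [d [iE _ Sgen dP]]]]] :=
  @common_subalgebra L A A xs e e (fun _ _ _ => iff_refl _).
have KS := universal_class_embedding KU iE KA.
have down phi : qf phi -> {subset fv phi <= xs} -> sat e phi -> sat d phi.
  move=> qphi phixs ephi; apply/(sat_embedding d iE qphi).
  by move: ephi; apply: (iffRL (sat_ext _)) => x /phixs/dP[].
have dchi : sat d chi by exact: down.
have deqs s t : {subset fv (Feq s t) <= xs} ->
    Kmodels K (Fimp (lits_pos ls) (Feq s t)) -> sat d (Feq s t).
  by move=> stxs Kst; apply: (xiP _ _ stxs Kst S KS d); exact: down.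
have [B [h [b [KB [hE hb]]]]] := chiP S d KS Sgen dchi deqs.
have [D [u [v [KD [uE [vE uv]]]]]] := AP KS KA KB iE hE.
exists D, u, (v b); split=> //; move: (solution_embedding vE hb).
apply: (iffLR (sat_ext _)) => x /lsxs; rewrite inE /upd; case: eqP => //= _ xxs.
by rewrite -uv; have [->] := dP x xxs.
Qed.

Definition ec_theory : theory L :=
  fun phi => sentence phi /\ forall A, ec A -> holds A phi.

Definition closure (phi : formula L) : formula L := foldr (@Fall L) phi (fv phi).

Lemma sentence_closure (phi : formula L) : sentence (closure phi).
Proof.
have fvP vs x : x \in fv (foldr (@Fall L) phi vs) -> (x \in fv phi) && (x \notin vs).
  elim: vs => [|v vs IH]; first by rewrite andbT.
  rewrite /= mem_filter /= => /andP[xv /IH/andP[-> xvs]].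
  by rewrite inE negb_or xv.
rewrite /sentence; case E: (fv (closure phi)) => [//|x s].
have /fvP : x \in fv (closure phi) by rewrite E inE eqxx.
by case: (x \in fv phi).
Qed.

Lemma holds_closure (A : algebra L) (phi : formula L) :
  holds A (closure phi) <-> holds A phi.
Proof.
by rewrite /closure; elim: (fv phi) => //= v vs IH; rewrite holds_Fall.
Qed.

(** The theory contains the universal axioms of [K] and, for each system, the closed implication
    from its solvability condition [theta] to the existence of a solution. These already force
    existential closedness. *)
Lemma ec_theoryP (A : algebra L) : is_model ec_theory A <-> ec A.
Proof.
split=> [TA|ecA phi [_]]; last exact.
split.
  have [Sg [SgU SgP]] := KU; apply/SgP => phi Sphi; apply: TA.
  split; first exact: (proj1 (SgU _ Sphi)).
  by move=> B [/SgP KB _]; exact: KB.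
move=> ls y e [B [h [b [KB hE hb]]]].
pose xs := [seq x <- fv (conj_lits ls) | x != y].
have yxs : y \notin xs by rewrite mem_filter eqxx.
have lsxs : {subset fv (conj_lits ls) <= y :: xs}.
  by move=> x xls; rewrite inE mem_filter xls andbT orbN.
have [theta [qt txs Kt tP]] := solvability_condition yxs lsxs.
have : holds A (Fimp theta (Fex y (conj_lits ls))).
  apply/holds_closure/TA; split; first exact: sentence_closure.
  by move=> C [KC ecC]; apply/holds_closure => d /(tP C d KC)/ecC.
apply; apply/(sat_embedding e hE qt); move: (Kt B KB _ hb).
apply: (iffLR (sat_ext (phi := theta) _)) => x /txs xxs.
by rewrite upd_other //; apply: contraNneq yxs => <-.
Qed.

(** * Quantifier elimination for existentially closed algebras *)

Lemma qf_atoms (chi : formula L) : qf chi ->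
  exists es : seq {classic Defs.eqn L},
  forall (A B : algebra L) (e : nat -> A) (e' : nat -> B),
    {in es, forall q, sat e (Feq q.1 q.2) <-> sat e' (Feq q.1 q.2)} ->
    sat e chi <-> sat e' chi.
Proof.
have in_catl (es1 es2 : seq {classic Defs.eqn L}) (P : Defs.eqn L -> Prop) :
    {in es1 ++ es2, forall q, P q} ->
    {in es1, forall q, P q} /\ {in es2, forall q, P q}.
  by move=> h; split=> q qs; apply: h; rewrite mem_cat qs ?orbT.
elim: chi => //= [s t _|p IH /IH[es h]|p IHp q IHq [/IHp[es1 h1] /IHq[es2 h2]]
  |p IHp q IHq [/IHp[es1 h1] /IHq[es2 h2]]|p IHp q IHq [/IHp[es1 h1] /IHq[es2 h2]]].
- by exists [:: (s, t)] => A B e e' /(_ (s, t)); apply; rewrite inE.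
- by exists es => A B e e' /h; tauto.
all: exists (es1 ++ es2) => A B e e' /in_catl[/h1 ? /h2 ?]; tauto.
Qed.

(** Tuples of [M] and [N] with the same equations share a subalgebra, over which [M] and [N]
    amalgamate into [D]. A witness in [M] becomes a solution in [D] of a system over [N], and [N] is
    existentially closed. *)
Lemma ec_qe_ex y (p chi : formula L) :
  qf chi -> {subset fv chi <= fv p} ->
  (forall (A : algebra L) (e : nat -> A), ec A -> sat e p <-> sat e chi) ->
  exists theta : formula L, [/\ qf theta, {subset fv theta <= fv (Fex y p)} &
    forall (A : algebra L) (e : nat -> A), ec A -> sat e (Fex y p) <-> sat e theta].
Proof.
move=> qchi chip chiP.
have [|theta [qt tp tP]] := @qf_of_type_determined L ec_theory (fv (Fex y p)) (Fex y p);
  last first.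
  by exists theta; split=> // A e /ec_theoryP; exact: tP.
move=> M N e e' /ec_theoryP ecM /ec_theoryP ecN ee' [a /chiP-/(_ ecM) ha].
have [S [i [j [d [iE jE _ dP]]]]] := common_subalgebra ee'.
have KS := universal_class_embedding KU iE (proj1 ecM).
have [D [u [v [KD [uE [vE uv]]]]]] := AP KS (proj1 ecM) (proj1 ecN) iE jE.
have {}ha : sat (upd (v \o e') y (u a)) chi.
  move: (iffRL (sat_embedding _ uE qchi) ha); rewrite upd_comp.
  apply: (iffLR (sat_ext _)) => x /chip xp; rewrite /upd; case: eqP => //= /eqP xy.
  have [|<- <-] := dP x; last exact: uv.
  by rewrite /= mem_filter /= xy.
have [es esP] := qf_atoms qchi.
(* The signs in [D] of the finitely many equations on which [chi] depends: a solution of this system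
   satisfies [chi]. *)
pose ls := [seq (`[<sat (upd (v \o e') y (u a)) (Feq q.1 q.2)>], q) : lit L | q <- es].
have [|b /sat_complete_lits hb] := proj2 ecN ls y e'.
  by exists D, v, (u a); split=> //; apply/sat_complete_lits.
by exists b; apply/chiP => //; apply/(esP _ _ _ _ hb).
Qed.

Lemma ec_qe (phi : formula L) :
  exists chi : formula L, [/\ qf chi, {subset fv chi <= fv phi} &
    forall (A : algebra L) (e : nat -> A), ec A -> sat e phi <-> sat e chi].
Proof.
have cat_mono (s1 s2 t1 t2 : seq nat) : {subset s1 <= t1} -> {subset s2 <= t2} ->
    {subset s1 ++ s2 <= t1 ++ t2}.
  by move=> h1 h2 x; rewrite !mem_cat => /orP[/h1->//|/h2->]; rewrite orbT.
elim: phi => [s t|p [c [qc fc cP]]|p [c [qc fc cP]] q [c' [qc' fc' cP']]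
  |p [c [qc fc cP]] q [c' [qc' fc' cP']]|p [c [qc fc cP]] q [c' [qc' fc' cP']]
  |x p [c [qc fc cP]]|x p [c [qc fc cP]]].
- by exists (Feq s t); split.
- by exists (Fnot c); split=> // A e ecA; have := cP A e ecA => /=; tauto.
- exists (Fand c c'); split; [by []|exact: cat_mono|].
  by move=> A e ecA; have := cP A e ecA; have := cP' A e ecA => /=; tauto.
- exists (For c c'); split; [by []|exact: cat_mono|].
  by move=> A e ecA; have := cP A e ecA; have := cP' A e ecA => /=; tauto.
- exists (Fimp c c'); split; [by []|exact: cat_mono|].
  by move=> A e ecA; have := cP A e ecA; have := cP' A e ecA => /=; tauto.
- have [|t [qt ft tP]] := @ec_qe_ex x (Fnot p) (Fnot c) qc fc.
    by move=> A e ecA; have := cP A e ecA => /=; tauto.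
  exists (Fnot t); split=> // A e ecA; split=> /=.
    by move=> h /(tP A e ecA)[a]; apply; exact: h.
  move=> h a; apply: contrapT => np; apply: h; apply/(tP A e ecA).
  by exists a.
- exact: ec_qe_ex qc fc cP.
Qed.

(** Quantifier elimination gives model completeness, and completeness of diagrams: a quantifier-free
    formula keeps in every extension the truth value it has in [M]. *)
Lemma ec_theory_model_completion : model_completion (Th K) ec_theory.
Proof.
split; first by move=> phi [].
split.
  move=> A B h /ec_theoryP ecA /ec_theoryP ecB hE phi e.
  have [chi [qchi _ chiP]] := ec_qe phi.
  by rewrite !chiP //; apply: iff_sym; exact: sat_embedding.
split.
  move=> phi _ uphi; split=> h A.
    by move=> /ec_theoryP[KA _]; apply/h/(is_model_Th KU).
  move=> /(is_model_Th KU)/ec_extension[E [g [ecE gE]]].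
  by apply: (universal_embedding gE uphi); apply/h/ec_theoryP.
move=> M /(is_model_Th KU) KM; split.
  by have [E [g [ecE gE]]] := ec_extension KM; exists E, g;
    split=> //; apply/ec_theoryP.
move=> phi e; have [chi [qchi _ chiP]] := ec_qe phi.
by have [ec|nec] := pselect (sat e chi); [left|right] => N h /ec_theoryP ecN hE;
  rewrite chiP // sat_embedding.
Qed.

End ExistentiallyClosed.

Theorem theorem3p2 (L : lang) (K : algebra L -> Prop) :
  universal_class K ->
  (has_model_completion (Th K) <->
     [/\ amalgamation K, variable_projection K & conservative_model_extension K]).
Proof.
move=> KU; split=> [[Ts mc]|[AP VP CE]].
  split; first exact: completion_amalgamation mc.
    exact: completion_variable_projection mc.
  exact: completion_conservative_extension mc.
by exists (ec_theory K); exact: ec_theory_model_completion.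
Qed.
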